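(* Let $\mathcal{H}$ be a hypergraph with rank $r$ and co-rank $s$, with signless Laplacian matrix $\mathbf{Q}$. If $\mathbf{A}_{\mathcal{L}}$ is the adjacency matrix of its line multigraph $\mathcal{L}(\mathcal{H})$, then $$\rho(\mathbf{Q})-r\leq\rho(\mathbf{A}_{\mathcal{L}})\leq\rho(\mathbf{Q})-s.$$ Furthermore, either equality holds if and only if $\mathcal{H}$ is uniform (that is, each of the two equalities, separately, is equivalent to $\mathcal{H}$ being uniform).
   Context: A hypergraph $\mathcal{H}=(V,E)$ consists of a finite set $V$ of vertices and a set $E$ of non-empty subsets of $V$, called hyperedges. All hypergraphs are assumed simple (no hyperedge has cardinality one and no hyperedge is contained in another) and connected (any two vertices are joined by a path, i.e. an alternating sequence of distinct vertices and hyperedges in which each hyperedge contains the vertices immediately before and after it). The rank and co-rank of $\mathcal{H}$ are the largest and smallest cardinality of its hyperedges, respectively (so $E\neq\emptyset$ when they are mentioned). $\mathcal{H}$ is uniform if all its hyperedges have the same cardinality. The line multigraph $\mathcal{L}(\mathcal{H})$ is the multigraph with vertex set $E$ in which two distinct vertices $e,f\in E$ are joined by exactly $|e\cap f|$ edges (no loops). The adjacency matrix of a multigraph has zero diagonal, and for $u\neq v$ its $(u,v)$ entry is the number of edges joining $u$ and $v$. The incidence matrix $\mathbf{B}$ is the $|V|\times|E|$ matrix with $(v,e)$ entry $1$ if $v\in e$ and $0$ otherwise. The signless Laplacian matrix of $\mathcal{H}$ is the $|V|\times|V|$ matrix $\mathbf{Q}=\mathbf{Q}(\mathcal{H})=\mathbf{B}\mathbf{B}^{\mathrm{T}}$.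 For a matrix $\mathbf{M}$ of either type, $\rho(\mathbf{M})$ denotes its spectral radius, i.e. its largest eigenvalue. *)

(* Defs.v *)
From HB Require Import structures.
From mathcomp Require Import all_boot all_order all_algebra.
From mathcomp Require classical_sets.
From mathcomp Require Import reals.

Set Implicit Arguments.
Unset Strict Implicit.
Unset Printing Implicit Defensive.

Import Order.TTheory GRing.Theory Num.Theory.
Local Open Scope ring_scope.

Record hypergraph (V : finType) := Hypergraph {
  hyperedges : {set {set V}};
  hyperedges_nonempty : set0 \notin hyperedges
}.

Definition simple_hypergraph (V : finType) (H : hypergraph V) : Prop :=
  (forall e, e \in hyperedges H -> #|e| != 1%N) /\
  (forall e f, e \in hyperedges H -> f \in hyperedges H ->
     e \subset f -> e = f).

(* The alternating sequence x, e_1, v_1, ..., e_k, v_k is encoded by its first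
   vertex x and the list p = [:: (e_1, v_1); ...; (e_k, v_k)]. *)
Fixpoint hwalk (V : finType) (H : hypergraph V) (x : V)
    (p : seq ({set V} * V)) : bool :=
  if p is (e, y) :: p' then
    [&& e \in hyperedges H, x \in e, y \in e & hwalk H y p']
  else true.

Definition hpath (V : finType) (H : hypergraph V) (x : V)
    (p : seq ({set V} * V)) : bool :=
  [&& hwalk H x p, uniq (x :: unzip2 p) & uniq (unzip1 p)].

Definition connected_hypergraph (V : finType) (H : hypergraph V) : Prop :=
  forall x y : V, exists2 p, hpath H x p & last x (unzip2 p) = y.

Definition hrank (V : finType) (H : hypergraph V) : nat :=
  \max_(e in hyperedges H) #|e|.

(* The default value #|V| bounds every #|e|, so it is harmless as soon as
   there is a hyperedge. *)
Definition hcorank (V : finType) (H : hypergraph V) : nat :=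
  \big[minn/#|V|]_(e in hyperedges H) #|e|.

Definition uniform_hypergraph (V : finType) (H : hypergraph V) : Prop :=
  forall e f, e \in hyperedges H -> f \in hyperedges H -> #|e| = #|f|.

(* A loopless undirected multigraph, given by its edge multiplicities. *)
Record multigraph (T : finType) := Multigraph {
  edge_mult : T -> T -> nat;
  edge_mult_sym : forall u v, edge_mult u v = edge_mult v u;
  edge_mult_loopless : forall u, edge_mult u u = 0%N
}.

Definition adjacency_mx (R : realType) (T : finType) (G : multigraph T) :
    'M[R]_#|T| :=
  \matrix_(i, j) (edge_mult G (enum_val i) (enum_val j))%:R.

Definition hyperedge (V : finType) (H : hypergraph V) : finType :=
  {e : {set V} | e \in hyperedges H}.

Definition line_mult (V : finType) (H : hypergraph V)
    (e f : hyperedge H) : nat :=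
  if e == f then 0%N else #|val e :&: val f|.

Lemma line_mult_sym (V : finType) (H : hypergraph V) (e f : hyperedge H) :
  line_mult e f = line_mult f e.
Proof. by rewrite /line_mult eq_sym setIC. Qed.

Lemma line_mult_loopless (V : finType) (H : hypergraph V) (e : hyperedge H) :
  line_mult e e = 0%N.
Proof. by rewrite /line_mult eqxx. Qed.

Definition line_multigraph (V : finType) (H : hypergraph V) :
    multigraph (hyperedge H) :=
  Multigraph (@line_mult_sym V H) (@line_mult_loopless V H).

Definition incidence_mx (R : realType) (V : finType) (H : hypergraph V) :
    'M[R]_(#|V|, #|hyperedge H|) :=
  \matrix_(i < #|V|, j < #|hyperedge H|)
    ((enum_val i : V) \in val (enum_val j : hyperedge H))%:R.

Definition signless_laplacian (R : realType) (V : finType)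
    (H : hypergraph V) : 'M[R]_#|V| :=
  incidence_mx R H *m (incidence_mx R H)^T.

Definition largest_eigenvalue (R : realType) (n : nat) (M : 'M[R]_n)
    (a : R) : Prop :=
  eigenvalue M a /\ (forall b, eigenvalue M b -> b <= a).

(* The largest eigenvalue exists (and is unique) for every real symmetric
   matrix of positive size; the default 0 only concerns other matrices. *)
Definition spectral_radius (R : realType) (n : nat) (M : 'M[R]_n) : R :=
  classical_sets.xget 0 (largest_eigenvalue M).

(* Main.v *)
(* Write B for the incidence matrix and N = B^T B.  Then rho(N) = rho(B B^T) =
   rho(Q), and N is the adjacency matrix A of the line multigraph plus the
   diagonal matrix of the sizes |e|, which lie between s and r.  Both bounds
   follow by comparing Rayleigh quotients of A and N at top eigenvectors.  In
   the equality cases a vector maximizes the Rayleigh quotient of N, while only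
   hyperedges of extremal size are in its support; connectivity and
   Perron-Frobenius make that support everything. *)
From mathcomp Require Import boolp classical_sets topology normedtype derive.
From mathcomp Require Import ring.
(* The libraries above come first so that [set0] is the one of [finset]. *)
Require Import Defs.
From mathcomp Require Import all_boot all_order all_algebra.
From mathcomp Require Import reals.
Import Order.TTheory GRing.Theory Num.Theory.
Import numFieldNormedType.Exports.
Local Open Scope ring_scope.

(** * The inner product of row vectors *)

Definition dotv {R : realType} {n : nat} (u v : 'rV[R]_n) : R :=
  \sum_i u 0 i * v 0 i.

Lemma dotvC {R : realType} {n : nat} (u v : 'rV[R]_n) : dotv u v = dotv v u.
Proof. by apply: eq_bigr => i _; rewrite mulrC. Qed.

Lemma dotvDl {R : realType} {n : nat} (u v w : 'rV[R]_n) :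
  dotv (u + v) w = dotv u w + dotv v w.
Proof. by rewrite -big_split; apply: eq_bigr => i _; rewrite mxE mulrDl. Qed.

Lemma dotvZl {R : realType} {n : nat} (a : R) (u v : 'rV[R]_n) :
  dotv (a *: u) v = a * dotv u v.
Proof. by rewrite mulr_sumr; apply: eq_bigr => i _; rewrite mxE mulrA. Qed.

Lemma dotvDr {R : realType} {n : nat} (u v w : 'rV[R]_n) :
  dotv w (u + v) = dotv w u + dotv w v.
Proof. by rewrite !(dotvC w) dotvDl. Qed.

Lemma dotvZr {R : realType} {n : nat} (a : R) (u v : 'rV[R]_n) :
  dotv v (a *: u) = a * dotv v u.
Proof. by rewrite !(dotvC v) dotvZl. Qed.

Lemma dotv_ge0 {R : realType} {n : nat} (u : 'rV[R]_n) : 0 <= dotv u u.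
Proof. by apply: sumr_ge0 => i _; rewrite -expr2 sqr_ge0. Qed.

Lemma dotv_eq0 {R : realType} {n : nat} (u : 'rV[R]_n) :
  (dotv u u == 0) = (u == 0).
Proof.
apply/eqP/eqP => [u0 | ->]; last by apply: big1 => i _; rewrite mxE mul0r.
apply/rowP => i; rewrite mxE; apply/eqP.
move/eqP: u0; rewrite psumr_eq0 => [/allP/(_ i (mem_index_enum i))|j _].
  by rewrite mulf_eq0 orbb.
by rewrite -expr2 sqr_ge0.
Qed.

Lemma dotv_gt0 {R : realType} {n : nat} (u : 'rV[R]_n) :
  u != 0 -> 0 < dotv u u.
Proof. by move=> u0; rewrite lt_def dotv_eq0 u0 dotv_ge0. Qed.

Lemma dotv_mulmx {R : realType} {m n : nat} (u : 'rV[R]_m) (M : 'M[R]_(m, n))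
    (v : 'rV[R]_n) :
  dotv (u *m M) v = dotv u (v *m M^T).
Proof.
have dotvE k (x y : 'rV[R]_k) : dotv x y = (x *m y^T) 0 0.
  by rewrite mxE; apply: eq_bigr => i _; rewrite mxE.
by rewrite !dotvE trmx_mul trmxK mulmxA.
Qed.

(** * Rayleigh quotients and the largest eigenvalue of a symmetric matrix *)

Lemma continuous_dotv_mulmx {R : realType} {n : nat} (M : 'M[R]_n) :
  continuous (fun x : 'rV[R]_n => dotv (x *m M) x).
Proof.
have sum_continuous (T : topologicalType) (F : 'I_n -> T -> R) :
    (forall i, continuous (F i)) -> continuous (fun x => \sum_i F i x).
  move=> Fc; apply: continuous_big => [|i _]; last exact: Fc.
  exact: add_continuous.
apply: (sum_continuous) => i x.
have cM : continuous (fun y : 'rV[R]_n => (y *m M) 0 i).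
  rewrite (_ : (fun y : 'rV[R]_n => _) = fun y => \sum_j y 0 j * M j i).
    apply: sum_continuous => j y.
    by apply: continuousM; [exact: coord_continuous|exact: cst_continuous].
  by apply/funext => y; rewrite mxE.
by apply: continuousM; [exact: cM|exact: coord_continuous].
Qed.

(** First variation at the maximizer [v] in the direction of the residual [u]: the deficit of the
    bound at [v + t *: u] is [- 2tc + t^2 d] with [c = dotv u u]. It is nonnegative for all [t], and
    [t = c / (d + 1)] turns it into [- (d + 2) t^2], which forces [c = 0]. *)
Lemma rayleigh_eigenvector {R : realType} {n : nat} (M : 'M[R]_n) (a : R)
    (v : 'rV[R]_n) :
  M^T = M -> (forall x, dotv (x *m M) x <= a * dotv x x) ->
  dotv (v *m M) v = a * dotv v v -> v *m M = a *: v.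
Proof.
move=> Msym Mle vmax.
have [u uE] : exists u, u = v *m M - a *: v by exists (v *m M - a *: v).
pose c := dotv u u; pose d := a * dotv u u - dotv (u *m M) u.
have d0 : 0 <= d by rewrite subr_ge0 Mle.
have cE : dotv (v *m M) u - a * dotv v u = c.
  by rewrite -mulNr -dotvZl -dotvDl scaleNr -uE.
have quad t : 0 <= - (2 * t * c) + t ^+ 2 * d.
  have := Mle (v + t *: u).
  rewrite mulmxDl -scalemxAl !(dotvDl, dotvDr, dotvZl, dotvZr) vmax.
  have -> : dotv (u *m M) v = dotv (v *m M) u by rewrite dotv_mulmx Msym dotvC.
  rewrite (dotvC u v) -subr_ge0 -cE /d; set p := dotv (v *m M) u.
  by congr (0 <= _); ring.
have d1 : 0 < d + 1 by rewrite ltr_wpDl.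
have d2 : 0 < d + 1 + 1 by rewrite ltr_wpDl // ltW.
have d1n0 : d + 1 != 0 by rewrite gt_eqF.
(* [d + 1] rather than [d], which may vanish *)
have := quad (c / (d + 1)).
have -> : - (2 * (c / (d + 1)) * c) + (c / (d + 1)) ^+ 2 * d
    = - ((d + 1 + 1) * (c / (d + 1)) ^+ 2) by field.
rewrite oppr_ge0 pmulr_rle0 // => sq_le0.
have : (c / (d + 1)) ^+ 2 == 0 by rewrite eq_le sq_le0 sqr_ge0.
rewrite sqrf_eq0 mulf_eq0 invr_eq0 (negPf d1n0) orbF dotv_eq0.
by rewrite uE subr_eq0 => /eqP.
Qed.

(** The quadratic form is continuous on the compact unit sphere, and homogeneity carries its maximum
    there to all vectors. The product form of the inequality also covers [x = 0]. *)
Lemma rayleigh_attained {R : realType} {n : nat} (M : 'M[R]_n) :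
  (0 < n)%N -> exists2 v : 'rV[R]_n, v != 0 &
  forall x, dotv (x *m M) x * dotv v v <= dotv (v *m M) v * dotv x x.
Proof.
move=> n_gt0.
pose S := ([set x : 'rV[R]_n | dotv x x = 1])%classic.
have cdot : continuous (fun x : 'rV[R]_n => dotv x x).
  rewrite (_ : (fun _ => _) = fun x : 'rV[R]_n => dotv (x *m 1%:M) x).
    exact: continuous_dotv_mulmx.
  by apply/funext => x; rewrite mulmx1.
have S0 : (S !=set0)%classic.
  exists (delta_mx 0 (Ordinal n_gt0)).
  rewrite /S /= /dotv (bigD1 (Ordinal n_gt0)) //= big1 => [|i /negPf i0].
    by rewrite !mxE !eqxx mulr1 addr0.
  by rewrite !mxE i0 andbF mul0r.
have Scompact : compact S.
  pose B := ([set x : 'rV[R]_n | forall i,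
    `[- 1, 1]%classic (x ord0 i)])%classic.
  (* The sphere is closed and lies in the compact cube [B]: each squared coordinate is at most their
     sum, 1. *)
  apply: (@subclosed_compact _ _ B).
  - apply: (@preimage_closed _ _ _ [set x : R | x = 1]%classic).
      by move=> x _; exact: cdot.
    exact: closed_eq.
  - have := @rV_compact R n (fun=> `[- 1, 1]%classic); apply=> _.
    exact: segment_compact.
  move=> x Sx i /=; rewrite in_itv /= -ler_norml.
  rewrite -(@expr_le1 _ 2) // real_normK ?num_real // -[leRHS]Sx /dotv.
  rewrite (bigD1 i) //= -expr2 lerDl.
  by apply: sumr_ge0 => j _; rewrite -expr2 sqr_ge0.
have [v /set_mem Sv vmax] := EVT_max_rV S0 Scompact
  (continuous_subspaceT (@continuous_dotv_mulmx _ _ M)).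
exists v => [|x].
  by rewrite -dotv_eq0 Sv oner_eq0.
rewrite Sv mulr1; have [->|x0] := eqVneq x 0.
  by rewrite mul0mx -(scale0r 0) !dotvZl !mul0r mulr0.
have d0 := dotv_gt0 _ x0.
have /vmax : (Num.sqrt (dotv x x))^-1 *: x \in S.
  apply/mem_set; rewrite /S /= dotvZl dotvZr mulrA -invfM -expr2.
  by rewrite sqr_sqrtr ?dotv_ge0 // mulVf ?gt_eqF.
rewrite -scalemxAl dotvZl dotvZr mulrA -invfM -expr2 sqr_sqrtr ?dotv_ge0 //.
by rewrite ler_pdivrMl // mulrC.
Qed.

(** The maximal Rayleigh quotient is an eigenvalue, and it dominates every other one because the
    Rayleigh quotient of an eigenvector is its eigenvalue. *)
Lemma symmetric_largest_eigenvalue {R : realType} {n : nat} {M : 'M[R]_n} :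
  (0 < n)%N -> M^T = M ->
  exists2 a, largest_eigenvalue M a &
    forall x, dotv (x *m M) x <= a * dotv x x.
Proof.
move=> n_gt0 Msym; have [v v0 vmax] := rayleigh_attained M n_gt0.
have vv := dotv_gt0 _ v0; pose a := dotv (v *m M) v / dotv v v.
have Mle x : dotv (x *m M) x <= a * dotv x x by rewrite mulrAC ler_pdivlMr.
exists a => //; split=> [|c /eigenvalueP[w wM w0]].
  apply/eigenvalueP; exists v => //; apply: rayleigh_eigenvector => //.
  by rewrite divfK ?gt_eqF.
by have := Mle w; rewrite wM dotvZl ler_pM2r ?dotv_gt0.
Qed.

Lemma spectral_radiusP {R : realType} {n : nat} {M : 'M[R]_n} :
  (0 < n)%N -> M^T = M -> largest_eigenvalue M (spectral_radius M).
Proof.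
move=> n_gt0 Msym; have [a aP _] := symmetric_largest_eigenvalue n_gt0 Msym.
by apply: classical_sets.xgetPex; exists a.
Qed.

Lemma rayleigh_le_spectral_radius {R : realType} {n : nat} {M : 'M[R]_n}
    (x : 'rV[R]_n) :
  (0 < n)%N -> M^T = M -> dotv (x *m M) x <= spectral_radius M * dotv x x.
Proof.
move=> n_gt0 Msym.
have [a [eva _] ale] := symmetric_largest_eigenvalue n_gt0 Msym.
have [_ /(_ a eva) a_le] := spectral_radiusP n_gt0 Msym.
by apply: le_trans (ale x) _; rewrite ler_wpM2r ?dotv_ge0.
Qed.

(** An eigenvector [v] of [B *m B^T] with nonzero eigenvalue yields the eigenvector [v *m B] of
    [B^T *m B] with the same eigenvalue. *)
Lemma spectral_radius_mulmx_tr_le {R : realType} {m n : nat}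
    (B : 'M[R]_(m, n)) :
  (0 < m)%N -> (0 < n)%N ->
  spectral_radius (B *m B^T) <= spectral_radius (B^T *m B).
Proof.
move=> m0 n0.
have sym k l (C : 'M[R]_(k, l)) : (C *m C^T)^T = C *m C^T.
  by rewrite trmx_mul trmxK.
have symB : (B^T *m B)^T = B^T *m B by rewrite trmx_mul trmxK.
have [ev _] := spectral_radiusP m0 (sym _ _ B).
have [ev2 gmax] := spectral_radiusP n0 symB.
(* For eigenvalue 0 the vector [v *m B] vanishes; there it is enough that [B^T *m B] is positive
   semidefinite. *)
have [rho0|rho_neq0] := eqVneq (spectral_radius (B *m B^T)) 0.
  rewrite rho0; have /eigenvalueP[w wE w0] := ev2.
  have := dotv_ge0 (w *m B^T).
  rewrite dotv_mulmx trmxK -mulmxA wE dotvZr pmulr_lge0 //.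
  exact: dotv_gt0.
have /eigenvalueP[v vE v0] := ev; apply/gmax/eigenvalueP; exists (v *m B).
  by rewrite mulmxA -(mulmxA v) vE scalemxAl.
apply/eqP => vB0; move/eqP: vE; rewrite mulmxA vB0 mul0mx eq_sym scaler_eq0.
by rewrite (negPf rho_neq0) (negPf v0).
Qed.

Lemma spectral_radius_mulmx_tr {R : realType} {m n : nat}
    (B : 'M[R]_(m, n)) :
  (0 < m)%N -> (0 < n)%N ->
  spectral_radius (B *m B^T) = spectral_radius (B^T *m B).
Proof.
move=> m0 n0; apply/eqP; rewrite eq_le spectral_radius_mulmx_tr_le //=.
by have := @spectral_radius_mulmx_tr_le R n m B^T n0 m0; rewrite trmxK.
Qed.

(** * Perron-Frobenius for nonnegative symmetric matrices *)

Definition absv {R : realType} {n : nat} (x : 'rV[R]_n) : 'rV[R]_n :=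
  map_mx Num.norm x.

Lemma dotv_absv {R : realType} {n : nat} (x : 'rV[R]_n) :
  dotv (absv x) (absv x) = dotv x x.
Proof.
apply: eq_bigr => i _; rewrite mxE -normrM ger0_norm //.
by rewrite -expr2 sqr_ge0.
Qed.

Lemma dotv_mulmx_absv {R : realType} {n : nat} (M : 'M[R]_n) (x : 'rV[R]_n) :
  (forall i j, 0 <= M i j) ->
  dotv (x *m M) x <= dotv (absv x *m M) (absv x).
Proof.
move=> M0; apply: ler_sum => i _; rewrite !mxE !mulr_suml.
apply: ler_sum => j _; rewrite !mxE.
by rewrite -[X in _ <= _ * X * _]ger0_norm // -!normrM ler_norm.
Qed.

(** Taking absolute values preserves the norm and does not decrease the quadratic form, so [absv x]
    is a maximizer too. *)
Lemma perron_absv {R : realType} {n : nat} {M : 'M[R]_n} {x : 'rV[R]_n} :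
  (0 < n)%N -> M^T = M -> (forall i j, 0 <= M i j) ->
  dotv (x *m M) x = spectral_radius M * dotv x x ->
  absv x *m M = spectral_radius M *: absv x.
Proof.
move=> n0 Msym M0 xmax; apply: rayleigh_eigenvector => // [y|].
  exact: rayleigh_le_spectral_radius.
apply/eqP; rewrite eq_le rayleigh_le_spectral_radius //= dotv_absv -xmax.
exact: dotv_mulmx_absv.
Qed.

(** The hypothesis on [Z] is irreducibility. Where [x] vanishes, the eigenvalue equation of [absv x]
    says that a sum of nonnegative terms is 0, so the zero set of [x] is closed under nonzero
    entries of [M]; one zero would make [x] null. *)
Lemma perron_neq0 {R : realType} {n : nat} {M : 'M[R]_n} {x : 'rV[R]_n} :
  (0 < n)%N -> M^T = M -> (forall i j, 0 <= M i j) ->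
  (forall Z : pred 'I_n, (forall i j, Z i -> M i j != 0 -> Z j) ->
     forall i j, Z i -> Z j) ->
  dotv (x *m M) x = spectral_radius M * dotv x x -> x != 0 ->
  forall i, x 0 i != 0.
Proof.
move=> n0 Msym M0 Mirr xmax xn0 i; apply/eqP => xi0.
have xE := perron_absv n0 Msym M0 xmax.
move/eqP: xn0; apply; apply/rowP => k; rewrite mxE.
apply/eqP/(Mirr (fun j => x 0 j == 0) _ i); last exact/eqP.
move=> {xi0 k}i j /eqP xi0 Mij.
have := congr1 (fun u : 'rV_n => u 0 i) xE; rewrite !mxE xi0 normr0 mulr0.
move/eqP; rewrite psumr_eq0 => [/allP/(_ j (mem_index_enum j))|k _].
  have -> : M j i = M i j by rewrite -{1}Msym mxE.
  by rewrite mxE mulf_eq0 normr_eq0 (negPf Mij) orbF.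
by rewrite mxE mulr_ge0.
Qed.

(** * Rank, co-rank and connectivity of hypergraphs *)

Lemma le_hrank {V : finType} (H : hypergraph V) (e : {set V}) :
  e \in hyperedges H -> (#|e| <= hrank H)%N.
Proof. exact: (@leq_bigmax_cond _ (mem (hyperedges H)) (fun e => #|e|)). Qed.

Lemma hcorank_le {V : finType} (H : hypergraph V) (e : {set V}) :
  e \in hyperedges H -> (hcorank H <= #|e|)%N.
Proof.
by move=> eH; rewrite /hcorank -leEnat -minEnat; exact: bigmin_le_cond.
Qed.

Lemma hrank_uniform {V : finType} (H : hypergraph V) (e : {set V}) :
  uniform_hypergraph H -> e \in hyperedges H -> hrank H = #|e|.
Proof.
move=> Hunif eH; apply/eqP; rewrite eqn_leq le_hrank // andbT.
by apply/bigmax_leqP => f fH; rewrite (Hunif f e).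
Qed.

Lemma hcorank_uniform {V : finType} (H : hypergraph V) (e : {set V}) :
  uniform_hypergraph H -> e \in hyperedges H -> hcorank H = #|e|.
Proof.
move=> Hunif eH; apply/eqP; rewrite eqn_leq hcorank_le //=.
rewrite /hcorank; elim/big_ind: _ => [|m n em en|f fH].
(* The default [#|V|] of the minimum. *)
- exact: max_card.
- by rewrite leq_min em.
by rewrite (Hunif e f).
Qed.

(** The hyperedge [e], those of the walk, and [f] form a chain whose neighbours share a vertex, so
    [Z] propagates along it. *)
Lemma hwalk_meet_closed {V : finType} (H : hypergraph V)
    (Z : pred {set V}) :
  (forall e f, e \in hyperedges H -> f \in hyperedges H ->
     e :&: f != set0 -> Z e -> Z f) ->
  forall p x e f, hwalk H x p ->
  e \in hyperedges H -> f \in hyperedges H ->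
  x \in e -> last x (unzip2 p) \in f -> Z e -> Z f.
Proof.
move=> Zmeet; elim=> [|[g y] p IH] x e f /= => [_|/and4P[gH xg yg yp]] eH fH xe.
  by move=> xf; apply: Zmeet => //; apply/set0Pn; exists x; rewrite inE xe.
move=> lastf Ze; apply: (IH y g f) => //.
by apply: (Zmeet e) => //; apply/set0Pn; exists x; rewrite inE xe.
Qed.

(** This is connectivity of the line multigraph, in the form needed for irreducibility. Hyperedges
    are nonempty, so a path can start in [e] and end in [f]. *)
Lemma connected_meet_closed {V : finType} (H : hypergraph V)
    (Z : pred {set V}) :
  connected_hypergraph H ->
  (forall e f, e \in hyperedges H -> f \in hyperedges H ->
     e :&: f != set0 -> Z e -> Z f) ->
  forall e f, e \in hyperedges H -> f \in hyperedges H -> Z e -> Z f.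
Proof.
move=> Hconn Zmeet e f eH fH.
have nonempty g : g \in hyperedges H -> exists x, x \in g.
  by move=> gH; apply/set0Pn; apply: contraNneq (hyperedges_nonempty H) => <-.
have [[x xe] [y yf]] := (nonempty e eH, nonempty f fH).
have [p /and3P[xp _ _] lastp] := Hconn x y.
by apply: (hwalk_meet_closed _ _ Zmeet _ _ _ _ xp); rewrite ?lastp.
Qed.

(** * The Gram matrix of the incidence matrix *)

Lemma incidence_gramE {R : realType} {V : finType} (H : hypergraph V) i j :
  ((incidence_mx R H)^T *m incidence_mx R H) i j =
  #|val (enum_val i) :&: val (enum_val j)|%:R.
Proof.
rewrite mxE; under eq_bigr do rewrite !mxE -natrM mulnb.
rewrite -natr_sum -sum1_card [in RHS]big_mkcond /=; congr _%:R.
rewrite [RHS](reindex _ (onW_bij _ (@enum_val_bij V))) /=.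
by apply: eq_bigr => k _; rewrite inE; case: (_ && _).
Qed.

(** Off the diagonal the Gram entries are the multiplicities of the line multigraph; having no
    loops, it leaves the diagonal entries to the second sum. *)
Lemma dotv_incidence_gram {R : realType} {V : finType} (H : hypergraph V)
    (x : 'rV[R]_#|hyperedge H|) :
  dotv (x *m ((incidence_mx R H)^T *m incidence_mx R H)) x =
  dotv (x *m adjacency_mx R (line_multigraph H)) x +
  \sum_i #|val (enum_val i : hyperedge H)|%:R * x 0 i ^+ 2.
Proof.
pose d := \row_i #|val (enum_val i : hyperedge H)|%:R : 'rV[R]_#|hyperedge H|.
have -> : (incidence_mx R H)^T *m incidence_mx R H =
    adjacency_mx R (line_multigraph H) + diag_mx d.
  apply/matrixP => i j; rewrite incidence_gramE !mxE /= /line_mult.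
  rewrite (inj_eq enum_val_inj); have [->|ij] := eqVneq i j.
    by rewrite setIid add0r.
  by rewrite addr0.
rewrite mulmxDr dotvDl; congr (_ + _); apply: eq_bigr => i _.
by rewrite mul_mx_diag !mxE expr2 mulrA [x 0 i * _]mulrC.
Qed.

Theorem theorem5p3 (R : realType) (V : finType) (H : hypergraph V)
    (H_simple : simple_hypergraph H)
    (H_connected : connected_hypergraph H)
    (H_edges : hyperedges H != set0) :
  let rhoQ := spectral_radius (signless_laplacian R H) in
  let rhoA := spectral_radius (adjacency_mx R (line_multigraph H)) in
  let r : R := (hrank H)%:R in
  let s : R := (hcorank H)%:R in
  rhoQ - r <= rhoA /\ rhoA <= rhoQ - s /\
  (rhoQ - r = rhoA <-> uniform_hypergraph H) /\
  (rhoA = rhoQ - s <-> uniform_hypergraph H).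
Proof.
move=> rhoQ rhoA r s.
have [e0 e0H] := set0Pn _ H_edges.
have E_gt0 : (0 < #|hyperedge H|)%N.
  by apply/card_gt0P; exists (exist _ e0 e0H).
have V_gt0 : (0 < #|V|)%N.
  have /set0Pn[v ve0] : e0 != set0.
    by apply: contraNneq (hyperedges_nonempty H) => <-.
  by apply/card_gt0P; exists v.
pose N := (incidence_mx R H)^T *m incidence_mx R H.
pose A := adjacency_mx R (line_multigraph H).
pose w (i : 'I_#|hyperedge H|) : R := #|val (enum_val i : hyperedge H)|%:R.
have rhoQE : rhoQ = spectral_radius N by exact: spectral_radius_mulmx_tr.
have Nsym : N^T = N by rewrite trmx_mul trmxK.
have Asym : A^T = A.
  by apply/matrixP => i j; rewrite !mxE edge_mult_sym.
have N_ge0 i j : 0 <= N i j by rewrite incidence_gramE.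
(* Irreducibility of [N]: an entry is nonzero exactly when the two hyperedges meet. [Z'] carries [Z]
   from indices over to sets of vertices. *)
have Nirr (Z : pred 'I_#|hyperedge H|) :
    (forall i j, Z i -> N i j != 0 -> Z j) -> forall i j, Z i -> Z j.
  move=> Zstep i j Zi.
  pose Z' (e : {set V}) :=
    [exists k, (val (enum_val k : hyperedge H) == e) && Z k].
  have Z'E k : Z' (val (enum_val k)) = Z k.
    apply/existsP/idP => [[l /andP[/eqP/val_inj/enum_val_inj -> //]]|Zk].
    by exists k; rewrite eqxx.
  rewrite -Z'E.
  apply: (connected_meet_closed _ _ H_connected _ (val (enum_val i))).
  - move=> e f eH fH ef /existsP[k /andP[/eqP ke Zk]].
    pose l := enum_rank (exist _ f fH : hyperedge H).
    have lE : val (enum_val l) = f by rewrite enum_rankK.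
    rewrite -lE Z'E; apply: Zstep Zk _.
    by rewrite incidence_gramE ke lE pnatr_eq0 cards_eq0.
  - exact: valP.
  - exact: valP.
  by rewrite Z'E.
have w_ge i : s <= w i by rewrite ler_nat hcorank_le //; exact: valP.
have w_le i : w i <= r by rewrite ler_nat le_hrank //; exact: valP.
have w_uniform c : (forall i, w i = c) -> uniform_hypergraph H.
  move=> wc e f eH fH; apply/eqP; rewrite -(eqr_nat R); apply/eqP.
  have := wc (enum_rank (exist _ e eH)); rewrite /w enum_rankK /= => ->.
  by have := wc (enum_rank (exist _ f fH)); rewrite /w enum_rankK.
have weighted_eq (a b : 'I_#|hyperedge H| -> R) (x : 'rV[R]_#|hyperedge H|) :
    (forall i, x 0 i != 0) -> (forall i, a i <= b i) ->
    \sum_i a i * x 0 i ^+ 2 = \sum_i b i * x 0 i ^+ 2 -> forall i, a i = b i.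
  move=> x0 ab /eqP; rewrite eq_sym -subr_eq0 -sumrB psumr_eq0 => [|i _].
    move=> /allP xs i; have := xs i (mem_index_enum i).
    by rewrite -mulrBl mulf_eq0 sqrf_eq0 (negPf (x0 i)) orbF subr_eq0 => /eqP.
  by rewrite -mulrBl mulr_ge0 ?sqr_ge0 ?subr_ge0.
have const_sum c (x : 'rV[R]_#|hyperedge H|) :
    \sum_i c * x 0 i ^+ 2 = c * dotv x x.
  by rewrite mulr_sumr; apply: eq_bigr => i _; rewrite expr2.
have sum_le (a b : 'I_#|hyperedge H| -> R) (x : 'rV[R]_#|hyperedge H|) :
    (forall i, a i <= b i) ->
    \sum_i a i * x 0 i ^+ 2 <= \sum_i b i * x 0 i ^+ 2.
  by move=> ab; apply: ler_sum => i _; rewrite ler_wpM2r ?sqr_ge0.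
have [/eigenvalueP[x xN x0] _] := spectral_radiusP E_gt0 Nsym.
have [/eigenvalueP[y yA y0] _] := spectral_radiusP E_gt0 Asym.
have xx := dotv_gt0 _ x0; have yy := dotv_gt0 _ y0.
(* [z] is a top eigenvector of [N] with all entries positive. *)
pose z := absv x; have zz : 0 < dotv z z by rewrite dotv_absv.
have xmax : dotv (x *m N) x = spectral_radius N * dotv x x.
  by rewrite xN dotvZl.
have zmax : dotv (z *m N) z = rhoQ * dotv z z.
  by rewrite (perron_absv E_gt0 Nsym N_ge0 xmax) dotvZl rhoQE.
have z_neq0 i : z 0 i != 0.
  by rewrite mxE normr_eq0; exact: (perron_neq0 E_gt0 Nsym N_ge0 Nirr xmax x0).
(* The top eigenvector of [N] is tested against [A]; in [yN] below, that of [A] is tested against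
   [N]. *)
have zA : rhoQ * dotv z z <= rhoA * dotv z z + \sum_i w i * z 0 i ^+ 2.
  by rewrite -zmax dotv_incidence_gram lerD2r rayleigh_le_spectral_radius.
have yN : rhoA * dotv y y + \sum_i w i * y 0 i ^+ 2 <= rhoQ * dotv y y.
  by rewrite -dotvZl -yA -dotv_incidence_gram rhoQE rayleigh_le_spectral_radius.
have lower : rhoQ - r <= rhoA.
  rewrite lerBlDr -(ler_pM2r zz) mulrDl (le_trans zA) // lerD2l -const_sum.
  exact: sum_le.
have upper : rhoA <= rhoQ - s.
  rewrite lerBrDr -(ler_pM2r yy) mulrDl (le_trans _ yN) // lerD2l -const_sum.
  exact: sum_le.
have unif_eq : uniform_hypergraph H -> rhoQ - r = rhoA /\ rhoA = rhoQ - s.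
  (* With [r = s] the two bounds pinch [rhoA]. *)
  move=> Hunif; have rs : r = s.
    by rewrite /r /s (hrank_uniform _ e0) // (hcorank_uniform _ e0).
  have rhoE : rhoA = rhoQ - s by apply/eqP; rewrite eq_le upper -rs lower.
  by rewrite rs rhoE.
split=> //; split=> //; split; split=> [E|/unif_eq[] //].
(* Equality turns [zA] into the reverse of [w i <= r] summed with the weights [z 0 i ^+ 2], all of
   which are positive. *)
- apply: (w_uniform r); apply: (weighted_eq _ _ z) => //.
  apply/eqP; rewrite eq_le sum_le //= const_sum.
  by rewrite -(lerD2l (rhoA * dotv z z)) -mulrDl -E subrK E.
(* Here [y] might have zeros a priori. Equality makes the two weighted sums agree, so [y] also
   attains the maximum for [N], and irreducibility of [N] excludes zeros. *)
- have eqs : \sum_i s * y 0 i ^+ 2 = \sum_i w i * y 0 i ^+ 2.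
    apply/eqP; rewrite eq_le sum_le //= const_sum.
    by rewrite -(lerD2l (rhoA * dotv y y)) -[leRHS]mulrDl E subrK -E.
  have ymax : dotv (y *m N) y = spectral_radius N * dotv y y.
    rewrite dotv_incidence_gram yA dotvZl -/A -/rhoA -eqs const_sum -mulrDl.
    by rewrite E subrK rhoQE.
  have y_neq0 := perron_neq0 E_gt0 Nsym N_ge0 Nirr ymax y0.
  by apply: (w_uniform s) => i; apply/esym/(weighted_eq (fun=> s) w y).
Qed.
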